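(* Let $G_A(z,q)=\prod_{k=1}^\infty(1-z^{k-1}q^{2k-1})^{-1}$, $G_B(z,q)=\prod_{k=1}^\infty(1-z^kq^{2k})^{-1}$, and $F_n(z)=[q^n]\,G_A(z,q)G_B(z,q)$. Then for all $n\ge0$ and $0\le k\le n/3$, \[ [z^k]F_n(z)=[z^k]F_{n+1}(z)=\sum_{\ell=0}^k p(\ell)\,p(k-\ell), \] where $p(\ell)$ is the number of partitions of $\ell$.
   Context: $[q^n]$ and $[z^k]$ denote coefficient extraction. The product $G_AG_B$ is the Canfield–Savage–Wilf generating function $G_{2,2}(z,q)=\prod_{j\ge1}(1-z^{j-1}q^{2j-1})^{-1}(1-z^jq^{2j})^{-1}$ for partitions by the sum of their parts with even index. *)

(* Defs.v *)
From HB Require Import structures.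
From mathcomp Require Import all_boot all_order all_algebra finmap.
From mathcomp Require Import boolp classical_sets functions cardinality filter.
Set Implicit Arguments.
Unset Strict Implicit.
Unset Printing Implicit Defensive.
Import GRing.Theory.
Local Open Scope classical_set_scope.
Local Open Scope ring_scope.

(* Formal power series in one variable [q] over R; [coefq f n] is [q^n] f. *)
Record fps (R : Type) := Fps { coefq : nat -> R }.

Section FpsRing.
Variable R : comNzRingType.
Implicit Types f g h : fps R.

Lemma fpsP f g : (forall n, coefq f n = coefq g n) -> f = g.
Proof. by case: f => f; case: g => g /= fg; congr Fps; apply/funext. Qed.

HB.instance Definition _ := gen_eqMixin (fps R).
HB.instance Definition _ := gen_choiceMixin (fps R).

Definition fps_const (c : R) : fps R := Fps (fun n => if n == 0%N then c else 0).
Definition fps_q : fps R := Fps (fun n => (n == 1%N)%:R).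
Definition fps_add f g : fps R := Fps (fun n => coefq f n + coefq g n).
Definition fps_opp f : fps R := Fps (fun n => - coefq f n).
Definition fps_mul f g : fps R :=
  Fps (fun n => \sum_(i < n.+1) coefq f i * coefq g (n - i)).

Fact fps_addA : associative fps_add.
Proof. by move=> f g h; apply: fpsP => n /=; rewrite addrA. Qed.
Fact fps_addC : commutative fps_add.
Proof. by move=> f g; apply: fpsP => n /=; rewrite addrC. Qed.
Fact fps_add0 : left_id (fps_const 0) fps_add.
Proof. by move=> f; apply: fpsP => n /=; rewrite if_same add0r. Qed.
Fact fps_addN : left_inverse (fps_const 0) fps_opp fps_add.
Proof. by move=> f; apply: fpsP => n /=; rewrite if_same addNr. Qed.

HB.instance Definition _ :=
  GRing.isZmodule.Build (fps R) fps_addA fps_addC fps_add0 fps_addN.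

Let trunc n f : {poly R} := \poly_(i < n.+1) coefq f i.

Let truncE n f m : (m <= n)%N -> (trunc n f)`_m = coefq f m.
Proof. by move=> le_mn; rewrite coef_poly ltnS le_mn. Qed.

Let coefM_low n (p p' r r' : {poly R}) :
  (forall m, (m <= n)%N -> p`_m = p'`_m) ->
  (forall m, (m <= n)%N -> r`_m = r'`_m) -> (p * r)`_n = (p' * r')`_n.
Proof.
move=> ep er; rewrite !coefM; apply: eq_bigr => i _.
by rewrite ep ?er ?leq_subr // -ltnS.
Qed.

Let mul_trunc n f g m :
  (m <= n)%N -> coefq (fps_mul f g) m = (trunc n f * trunc n g)`_m.
Proof.
move=> le_mn; rewrite coefM; apply: eq_bigr => i _.
have le_in : (i <= n)%N by apply: leq_trans le_mn; rewrite -ltnS.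
by rewrite !truncE // (leq_trans (leq_subr _ _)).
Qed.

Fact fps_mulA : associative fps_mul.
Proof.
move=> f g h; apply: fpsP => n; rewrite !(mul_trunc _ _ (leqnn n)).
rewrite (@coefM_low n _ (trunc n f) _ (trunc n g * trunc n h)) //; last first.
  by move=> m le_mn; rewrite truncE // (mul_trunc _ _ le_mn).
rewrite mulrA; apply: coefM_low => // m le_mn.
by rewrite truncE // (mul_trunc _ _ le_mn).
Qed.
Fact fps_mulC : commutative fps_mul.
Proof. by move=> f g; apply: fpsP => n; rewrite !(mul_trunc _ _ (leqnn n)) mulrC. Qed.
Fact fps_mul1 : left_id (fps_const 1) fps_mul.
Proof.
move=> f; apply: fpsP => n /=; rewrite big_ord_recl /= mul1r subn0 big1 ?addr0 //.
by move=> i _; rewrite mul0r.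
Qed.
Fact fps_mulDl : left_distributive fps_mul fps_add.
Proof.
move=> f g h; apply: fpsP => n /=; rewrite -big_split /=.
by apply: eq_bigr => i _; rewrite mulrDl.
Qed.
Fact fps_1neq0 : fps_const 1 != fps_const 0.
Proof. by apply/eqP => /(congr1 (fun f => coefq f 0)) /eqP; rewrite /= oner_eq0. Qed.

HB.instance Definition _ := GRing.Zmodule_isComNzRing.Build (fps R)
  fps_mulA fps_mulC fps_mul1 fps_mulDl fps_1neq0.

(* The units are the invertible series, and f^-1 is the inverse of such an f. *)
Definition fps_unit : {pred fps R} := fun f => `[< exists g, g * f = 1 >].
Definition fps_inv f : fps R := xget f [set g | g * f = 1].

Fact fps_mulVx : {in fps_unit, left_inverse 1 fps_inv *%R}.
Proof. by move=> f /asboolP [g gf]; apply: (@xgetPex _ f [set g | g * f = 1]); exists g. Qed.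
Fact fps_unitPl f g : g * f = 1 -> fps_unit f.
Proof. by move=> gf; apply/asboolP; exists g. Qed.
Fact fps_inv_out : {in [predC fps_unit], fps_inv =1 id}.
Proof.
move=> f /negP nf; rewrite /fps_inv; case: xgetP => // g _ gf.
by case: nf; apply: fps_unitPl gf.
Qed.

HB.instance Definition _ := GRing.ComNzRing_hasMulInverse.Build (fps R)
  fps_mulVx fps_unitPl fps_inv_out.

(* The product of f k over k >= 1, in the q-adic topology: its n-th coefficient
   is the value at which the n-th coefficients of the partial products settle.
   It defaults to 0 when they do not; [fps_infprodP] covers the case at hand. *)
Definition fps_infprod (f : nat -> fps R) : fps R :=
  Fps (fun n => xget 0
    [set c | \forall M \near \oo, coefq (\prod_(1 <= k < M) f k) n = c]).

Lemma fps_infprodP (f : nat -> fps R) n :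
  (forall k i, (0 < k)%N -> (i < k)%N -> coefq (f k) i = (i == 0%N)%:R) ->
  \forall M \near \oo,
    coefq (\prod_(1 <= k < M) f k) n = coefq (fps_infprod f) n.
Proof.
move=> f1; pose P M := coefq (\prod_(1 <= k < M) f k) n.
apply: (@xgetPex _ 0 [set c | \forall M \near \oo, P M = c]).
have stepP M : (n < M)%N -> P M.+1 = P M.
  move=> lt_nM; rewrite /P big_nat_recr ?(leq_trans _ lt_nM) //=.
  set g := \prod_(1 <= k < M) f k.
  have f1M i : (i <= n)%N -> coefq (f M) i = (i == 0%N)%:R.
    by move=> le_in; rewrite f1 ?(leq_ltn_trans le_in) // (leq_trans _ lt_nM).
  rewrite [LHS]big_ord_recr /= subnn f1M // mulr1 big1 ?add0r // => i _.
  by rewrite f1M ?leq_subr // subn_eq0 leqNgt ltn_ord mulr0.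
exists (P n.+1), n.+1 => // M /= /subnKC <-.
by elim: (M - n.+1)%N => [|d IH]; rewrite ?addn0 // addnS stepP ?leq_addr.
Qed.

Lemma fps_unit_const1 f : coefq f 0 = 1 -> f \is a GRing.unit.
Proof.
move=> f0; pose fix b n := if n is m.+1 then
  rcons (b m) ((m == 0%N)%:R - \sum_(i < m) (b m)`_i * coefq f (m - i)) else [::].
have sb n : size (b n) = n by elim: n => //= n IH; rewrite size_rcons IH.
have bE n i : (i < n)%N -> (b n)`_i = (b i.+1)`_i.
  elim: n => // n IH; rewrite ltnS leq_eqVlt => /predU1P[-> //|lt_in].
  by rewrite -IH //= nth_rcons sb lt_in.
suff: Fps (fun n => (b n.+1)`_n) * f = 1 by exact: fps_unitPl.
apply: fpsP => n; rewrite /= big_ord_recr /= subnn f0 mulr1 nth_rcons sb ltnn eqxx.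
rewrite (eq_bigr (fun i : 'I_n => (b n)`_i * coefq f (n - i))) => [|i _].
  by rewrite addrC subrK; case: (n).
by rewrite [in RHS]bE.
Qed.

End FpsRing.

(* Partitions of n, as weakly decreasing sequences of positive integers. *)
Definition is_partition (n : nat) (s : seq nat) : bool :=
  [&& sorted geq s, all (leq 1) s & sumn s == n].

Lemma finite_partitions n : finite_set [set s | is_partition n s].
Proof.
pose f (p : {k : 'I_n.+1 & k.-tuple 'I_n.+1}) := map val (tagged p).
apply: (@sub_finite_set _ _ (range f)); last exact/finite_image/finite_finset.
move=> s /= /and3P[_ s_gt0 /eqP sn]; rewrite {}/f -{n}sn.
have le_size : (size s < (sumn s).+1)%N.
  elim: s s_gt0 => //= x s IH /andP[x_gt0 /IH]; rewrite !ltnS => le_s.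
  by rewrite -add1n leq_add.
have le_s : all (leq^~ (sumn s)) s.
  apply/allP => x; elim: (s) => //= y t IH; rewrite inE => /predU1P[->|/IH].
    exact: leq_addr.
  by move/leq_trans; apply; apply: leq_addl.
have st : size (map (@inord (sumn s)) s) == size s by rewrite size_map.
exists (Tagged (fun k : 'I__ => k.-tuple 'I_(sumn s).+1)
               (Tuple st : (Ordinal le_size).-tuple _)) => //=.
by rewrite -map_comp map_id_in // => x /(allP le_s) x_le; rewrite /= inordK.
Qed.

Definition partn_num (n : nat) : nat :=
  #|` fset_set [set s | is_partition n s] |%fset.

(* Series in q with coefficients in Z[z]; the variable z is the constant 'X. *)
Notation zqseries := (fps {poly int}).

Definition varz : zqseries := fps_const 'X.
Definition varq : zqseries := fps_q _.

Definition G_A : zqseries :=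
  fps_infprod (fun k => (1 - varz ^+ (k - 1) * varq ^+ (2 * k - 1))^-1).
Definition G_B : zqseries :=
  fps_infprod (fun k => (1 - varz ^+ k * varq ^+ (2 * k))^-1).

Definition F (n : nat) : {poly int} := coefq (G_A * G_B) n.

(* Main.v *)
(** The coefficients [h(n,k)] of [z^k q^n] in [h = f * (1 - z^a q^b)^-1] obey
    [h(n,k) = f(n,k) + h(n - b, k - a)].  Call [f] stable with limit [c] when
    [[z^k q^n] f = [w^k] c] as soon as [n >= 3k].  If [a >= 1] and [b <= 3a] the
    region [n >= 3k] is preserved by [(n,k) |-> (n - b, k - a)], so [f] stable
    with limit [c] makes [f * (1 - z^a q^b)^-1] stable with limit
    [c * (1 - w^a)^-1].  All factors of [G_A G_B] qualify except [(1 - q)^-1],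
    which is itself stable with limit [1]; hence the limit of [G_A G_B] is
    the square of Euler's product [\prod_(k >= 1) (1 - w^k)^-1]. *)
Require Import Defs.
From mathcomp Require Import all_boot all_order all_algebra.
From mathcomp Require Import finmap zify.
From mathcomp Require Import classical_sets cardinality filter.
Set Implicit Arguments.
Unset Strict Implicit.
Unset Printing Implicit Defensive.
Import GRing.Theory.
Local Open Scope classical_set_scope.
Local Open Scope ring_scope.

(** * Multiplication by geometric series, and coefficientwise limits *)

Section FpsGeometric.
Variable R : comNzRingType.
Implicit Types (f g : fps R) (c : R).

Lemma coefq1 n : coefq (1 : fps R) n = (n == 0%N)%:R.
Proof. by rewrite /=; case: eqP. Qed.

Lemma coefqD f g n : coefq (f + g) n = coefq f n + coefq g n.
Proof. by []. Qed.

Lemma coefqM f g n : coefq (f * g) n = \sum_(i < n.+1) coefq f i * coefq g (n - i).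
Proof. by []. Qed.

Lemma coefq_constM c f n : coefq (fps_const c * f) n = c * coefq f n.
Proof.
rewrite coefqM big_ord_recl /= subn0 big1 ?addr0 // => i _.
by rewrite mul0r.
Qed.

Lemma coefq_qM f n : coefq (fps_q R * f) n = if n is m.+1 then coefq f m else 0.
Proof.
rewrite coefqM big_ord_recl mul0r add0r; case: n => [|n]; first by rewrite big_ord0.
rewrite big_ord_recl /= mul1r subSS subn0 big1 ?addr0 // => i _.
by rewrite mul0r.
Qed.

Lemma coefq_qXM b f n :
  coefq (fps_q R ^+ b * f) n = if (b <= n)%N then coefq f (n - b) else 0.
Proof.
elim: b n => [|b IH] n; first by rewrite mul1r subn0.
by rewrite exprS -mulrA coefq_qM; case: n => [|n] //; rewrite IH.
Qed.

Lemma fps_constX c a : fps_const c ^+ a = fps_const (c ^+ a).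
Proof.
elim: a => [//|a IH]; rewrite !exprS IH; apply: fpsP => n.
by rewrite coefq_constM /=; case: eqP => _ //; rewrite mulr0.
Qed.

(** Since [b > 0], the series [1 - c q^b] has constant coefficient 1 and is a unit, so the
    hypothesis becomes [h = f + c q^b h]; reading off [[q^n]] gives a recurrence with no
    division. *)
Lemma coefq_mul_geom f h c b n : (0 < b)%N ->
  h = f * (1 - fps_const c * fps_q R ^+ b)^-1 ->
  coefq h n = coefq f n + if (b <= n)%N then c * coefq h (n - b) else 0.
Proof.
move=> b_gt0; set u := 1 - _ => hE.
have u_unit : u \is a GRing.unit.
  apply: fps_unit_const1.
  rewrite coefqD coefq1 -mulrN -mulrN1 !coefq_constM coefq_qXM.
  by rewrite leqNgt b_gt0 mulr0 addr0.
have -> : coefq h n = coefq (f + fps_const c * (fps_q R ^+ b * h)) n.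
  congr coefq; rewrite -[f](divrK u_unit) -hE mulrA [_ * h]mulrC -mulrDr.
  by rewrite subrK mulr1.
rewrite coefqD coefq_constM coefq_qXM.
by case: ifP => // _; rewrite mulr0.
Qed.

(** Supplies the hypothesis of [fps_infprodP] for the factors of [G_A] and [G_B]. *)
Lemma coefq_geom_low c b i : (i < b)%N ->
  coefq (1 - fps_const c * fps_q R ^+ b)^-1 i = (i == 0%N)%:R.
Proof.
move=> lt_ib; have b_gt0 : (0 < b)%N by apply: leq_ltn_trans lt_ib.
rewrite (coefq_mul_geom i b_gt0 (esym (mul1r _))) coefq1.
by rewrite leqNgt lt_ib addr0.
Qed.

Lemma near_coefq_low (f : nat -> fps R) g :
  (forall n, \forall M \near \oo, coefq (f M) n = coefq g n) ->
  forall n, \forall M \near \oo, forall i, (i <= n)%N -> coefq (f M) i = coefq g i.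
Proof.
move=> fg; elim=> [|n IH].
  by apply: filterS (fg 0%N) => M e i; rewrite leqn0 => /eqP ->.
apply: filterS (filterI IH (fg n.+1)) => M [e1 e2] i.
by rewrite leq_eqVlt ltnS => /predU1P[->|/e1].
Qed.

(** [[q^n]] of a product involves only the coefficients of index at most [n], and finitely many
    eventual equalities hold simultaneously. *)
Lemma near_coefqM (f1 f2 : nat -> fps R) g1 g2 :
  (forall n, \forall M \near \oo, coefq (f1 M) n = coefq g1 n) ->
  (forall n, \forall M \near \oo, coefq (f2 M) n = coefq g2 n) ->
  forall n, \forall M \near \oo, coefq (f1 M * f2 M) n = coefq (g1 * g2) n.
Proof.
move=> /near_coefq_low fg1 /near_coefq_low fg2 n.
apply: filterS (filterI (fg1 n) (fg2 n)) => M [e1 e2].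
rewrite !coefqM; apply: eq_bigr => i _.
by rewrite e1 ?e2 ?leq_subr // -ltnS.
Qed.

End FpsGeometric.

(** * Counting partitions with bounded parts *)

Section PartitionCount.

Definition partn_lt (M n : nat) : set (seq nat) :=
  [set s | is_partition n s && all (ltn^~ M) s].

Lemma partn_ltP M n s :
  partn_lt M n s <-> [/\ is_partition n s & all (ltn^~ M) s].
Proof. by rewrite /partn_lt /=; split=> [/andP[]|[-> ->]]. Qed.

Lemma is_partition_cons n x s :
  is_partition n (x :: s) =
    [&& all (geq x) s, (0 < x <= n)%N & is_partition (n - x) s].
Proof.
rewrite /is_partition /= path_sortedE; last by move=> a b c /=; lia.
case: (all (geq x) s) => //=; case: (sorted geq s); rewrite ?andbF //=.
by case: (all (leq 1) s); rewrite ?andbF //=; lia.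
Qed.

Lemma finite_partn_lt M n : finite_set (partn_lt M n).
Proof. by apply: sub_finite_set (finite_partitions n) => s /partn_ltP[]. Qed.

Lemma partn_lt1 n : partn_lt 1 n = if n == 0%N then [set [::]] else set0.
Proof.
apply/seteqP; split=> [[|x s]|s].
- by move=> /partn_ltP[]; rewrite /is_partition /= eq_sym => /eqP ->.
- by move=> /partn_ltP[]; rewrite is_partition_cons /=; lia.
- by case: n => [/= ->|].
Qed.

(** The head of a weakly decreasing list is its largest part: either it is below [M], or it equals
    [M] and can be removed. *)
Lemma partn_ltS M n : (0 < M)%N ->
  partn_lt M.+1 n =
    partn_lt M n `|` if (M <= n)%N then cons M @` partn_lt M.+1 (n - M) else set0.
Proof.
move=> M_gt0; apply/seteqP; split=> s.
  case: s => [|x s]; first by case/partn_ltP; left; apply/partn_ltP.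
  move=> /partn_ltP[]; rewrite is_partition_cons.
  move=> /and3P[le_s /andP[x_gt0 le_xn] s_part].
  rewrite /= => /andP[lt_xM lt_s]; have [xM|xM] := eqVneq x M.
    right; rewrite -xM le_xn; exists s => //.
    by apply/partn_ltP; split; rewrite // xM.
  left; apply/partn_ltP; rewrite is_partition_cons le_s x_gt0 le_xn s_part /=.
  have {}lt_xM : (x < M)%N by lia.
  by split=> //; rewrite lt_xM /=; apply: sub_all le_s => y /=; lia.
case=> [/partn_ltP[s_part s_lt]|].
  by apply/partn_ltP; split=> //; apply: sub_all s_lt => x /=; lia.
case: leqP => // le_Mn [t /partn_ltP[t_part t_lt] <-]; apply/partn_ltP.
by rewrite is_partition_cons M_gt0 le_Mn t_part /= ltnSn t_lt andbT; split.
Qed.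

Lemma card_partn_ltS M n : (0 < M)%N ->
  #|` fset_set (partn_lt M.+1 n)|%fset =
    (#|` fset_set (partn_lt M n)|%fset +
     if (M <= n)%N then #|` fset_set (partn_lt M.+1 (n - M))|%fset else 0)%N.
Proof.
move=> M_gt0; rewrite partn_ltS //; case: leqP => [le_Mn|_]; last first.
  by rewrite setU0 addn0.
have fin1 := finite_partn_lt M n; have fin2 := finite_partn_lt M.+1 (n - M).
rewrite fset_setU //; last exact: finite_image.
rewrite fset_set_image // cardfsU card_imfset /=; last by move=> ? ? [].
(* The union is disjoint: a list with head [M] does not have all its parts below [M]. *)
suff -> : (fset_set (partn_lt M n) `&`
   [fset M :: x | x in fset_set (partn_lt M.+1 (n - M))])%fset = fset0.
  by rewrite cardfs0 subn0.
apply/fsetP => s; rewrite inE [RHS]inE; apply/negP => /andP[].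
rewrite in_fset_set // => /set_mem /partn_ltP[_ s_lt] /imfsetP[t _ st].
by move: s_lt; rewrite st /= ltnn.
Qed.

Lemma partn_numE M n : (n < M)%N ->
  partn_num n = #|` fset_set (partn_lt M n)|%fset.
Proof.
move=> lt_nM; rewrite /partn_num; congr (#|` fset_set _|%fset).
apply/seteqP; split=> s; last by case/partn_ltP.
move=> /= s_part; apply/partn_ltP; split=> //; case/and3P: s_part => _ _ /eqP s_sum.
apply/allP => x xs /=; apply: leq_ltn_trans lt_nM; rewrite -s_sum.
elim: s xs {s_sum} => //= y s IH; rewrite inE => /predU1P[->|/IH]; lia.
Qed.

End PartitionCount.

(** * Truncated Euler products *)

Definition euler_prod (M : nat) : fps int :=
  \prod_(1 <= k < M) (1 - fps_q _ ^+ k)^-1.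

Lemma coefq_mul_euler_factor (f h : fps int) b n : (0 < b)%N ->
  h = f * (1 - fps_q _ ^+ b)^-1 ->
  coefq h n = coefq f n + if (b <= n)%N then coefq h (n - b) else 0.
Proof.
move=> b_gt0; rewrite -[fps_q _ ^+ b]mul1r => hE.
by rewrite (coefq_mul_geom n b_gt0 hE) mul1r.
Qed.

(** The recurrence of [card_partn_ltS] is the one that the factor [(1 - q^M)^-1] imposes on
    coefficients; hence an induction on [M], with a strong induction on [n] inside. *)
Lemma coefq_euler_prod M n : (0 < M)%N ->
  coefq (euler_prod M) n = (#|` fset_set (partn_lt M n)|%fset)%:R.
Proof.
rewrite /euler_prod; case: M => // M _; elim: M n => [|M IH] n.
  rewrite big_geq // coefq1 partn_lt1; case: eqP => _.
    by rewrite fset_set1 cardfs1.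
  by rewrite fset_set0 cardfs0.
elim/ltn_ind: n => n IHn.
have E : euler_prod M.+2 = euler_prod M.+1 * (1 - fps_q _ ^+ M.+1)^-1.
  by rewrite /euler_prod big_nat_recr.
rewrite -/(euler_prod _) (coefq_mul_euler_factor _ _ E) //.
rewrite card_partn_ltS // natrD -IH; congr (_ + _).
by case: leqP => // le_Mn; rewrite -IHn //; lia.
Qed.

Lemma coefq_euler_prod_partn M n : (n < M)%N ->
  coefq (euler_prod M) n = (partn_num n)%:R.
Proof.
move=> lt_nM; rewrite coefq_euler_prod ?(leq_ltn_trans _ lt_nM) //.
by rewrite -partn_numE.
Qed.

(** * Stability of the coefficients and the limit *)

Definition stable_to (f : zqseries) (c : fps int) : Prop :=
  forall n k, (3 * k <= n)%N -> (coefq f n)`_k = coefq c k.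

Lemma stable_to_mul f c a b : (0 < a)%N -> (0 < b <= 3 * a)%N ->
  stable_to f c ->
  stable_to (f * (1 - varz ^+ a * varq ^+ b)^-1) (c * (1 - fps_q _ ^+ a)^-1).
Proof.
move=> a_gt0 /andP[b_gt0 le_b] fc n k; rewrite [varz ^+ a]fps_constX.
elim/ltn_ind: k n => k IH n le_kn.
rewrite (coefq_mul_geom _ _ erefl) // (coefq_mul_euler_factor _ _ erefl) //.
rewrite coefD fc //; congr (_ + _).
(* If [k < a], the shifted terms vanish on both sides. Otherwise [b <= 3a <= 3k <= n] and
   [3(k - a) <= n - b], so the induction on [k] applies. *)
case: (leqP a k) => [le_ak|lt_ka]; last first.
  by case: ifP; rewrite ?coef0 // coefXnM lt_ka.
have -> : (b <= n)%N by lia.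
by rewrite coefXnM ltnNge le_ak /= IH //; lia.
Qed.

Lemma stable_to_geom_q :
  stable_to ((1 - varz ^+ 0 * varq ^+ 1)^-1) 1.
Proof.
move=> n k _; rewrite coefq1 [varz ^+ 0]fps_constX.
(* Here [a = 0], so the recurrence keeps [k] and lowers [n]: every [[q^n]] is the polynomial 1. *)
elim: n => [|n IH]; rewrite (coefq_mul_geom _ _ (esym (mul1r _))) // coefD coefq1.
  by rewrite coef0 addr0 coef1.
by rewrite coef0 add0r expr0 mul1r subSS subn0.
Qed.

(** The [k]-th factor of [G_A] has [a = k - 1], and its first factor has limit 1; this is why one
    Euler product is one factor shorter. The bound [b <= 3a] reads [2a + 1 <= 3a] for the later
    factors of [G_A] and [2a <= 3a] for those of [G_B]. *)
Lemma stable_to_partial_prod M :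
  stable_to
    (\prod_(1 <= k < M.+2) (1 - varz ^+ (k - 1) * varq ^+ (2 * k - 1))^-1 *
     \prod_(1 <= k < M.+2) (1 - varz ^+ k * varq ^+ (2 * k))^-1)
    (euler_prod M.+1 * euler_prod M.+2).
Proof.
rewrite -big_split /= /euler_prod; elim: M => [|M IH].
  rewrite big_nat1 big_geq // big_nat1.
  by apply: stable_to_mul => //; apply: stable_to_geom_q.
rewrite big_nat_recr //= [in X in stable_to _ (X * _)]big_nat_recr //=.
rewrite [X in stable_to _ (_ * X)]big_nat_recr //= [X in stable_to X _]mulrA.
rewrite [X in stable_to _ X]mulrACA [X in stable_to _ X]mulrA.
apply: stable_to_mul => //; first by lia.
by rewrite subSS subn0; apply: stable_to_mul => //; lia.
Qed.

Lemma coef_F n k : (3 * k <= n)%N ->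
  (F n)`_k = (\sum_(0 <= l < k.+1) partn_num l * partn_num (k - l))%:R.
Proof.
move=> le_kn.
have HA i := @fps_infprodP _
  (fun k => (1 - varz ^+ (k - 1) * varq ^+ (2 * k - 1))^-1) i.
have HB i := @fps_infprodP _ (fun k => (1 - varz ^+ k * varq ^+ (2 * k))^-1) i.
have : \forall M \near \oo,
    coefq (\prod_(1 <= k < M) (1 - varz ^+ (k - 1) * varq ^+ (2 * k - 1))^-1 *
     \prod_(1 <= k < M) (1 - varz ^+ k * varq ^+ (2 * k))^-1) n = F n.
  apply: near_coefqM => i.
    by apply: HA => j m *; rewrite [varz ^+ _]fps_constX coefq_geom_low //; lia.
  by apply: HB => j m *; rewrite [varz ^+ _]fps_constX coefq_geom_low //; lia.
(* This cutoff exceeds [N], so the partial products already give [F n], and it makes both Euler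
   products long enough to count all partitions of numbers up to [k]. *)
case=> N _ /(_ (N + k).+2) <-; last by rewrite /=; lia.
rewrite stable_to_partial_prod // coefqM big_mkord natr_sum.
apply: eq_bigr => i _; have := ltn_ord i => ?.
by rewrite !coefq_euler_prod_partn ?natrM //; lia.
Qed.

Theorem theorem4 (n k : nat) (hk : (3 * k <= n)%N) :
  (F n)`_k = (F n.+1)`_k /\
  (F n.+1)`_k = (\sum_(0 <= l < k.+1) partn_num l * partn_num (k - l))%:R.
Proof. by rewrite !coef_F // ltnW. Qed.
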